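(* Let $d\in\mathbb{N}$ and let $L_1$ be a random matrix taking values in the group $\mathcal{D}(d,\mathbb{C})$ of invertible diagonal matrices in $\mathbb{C}^{d\times d}$, with $\mathbb{E}\log^+\sigma_{\max}(L_1)<\infty$. Then $$\lambda_{\max}\big(\mathbb{E}\log(L_1L_1^\dagger)\big)=\max_{X\in\mathbb{X}'_{\bar{\mathcal{D}}}}\mathbb{E}\log\operatorname{tr}(XL_1L_1^\dagger)$$ and $$\lambda_{\min}\big(\mathbb{E}\log(L_1L_1^\dagger)\big)=\min_{X\in\mathbb{X}'_{\bar{\mathcal{D}}}}\mathbb{E}\log\operatorname{tr}(XL_1L_1^\dagger),$$ where $\mathbb{X}'_{\bar{\mathcal{D}}}:=\{YY^\dagger/\operatorname{tr}(YY^\dagger): Y\in\bar{\mathcal{D}}(d,\mathbb{C}),\ \operatorname{rank}Y=1\}$ and $\bar{\mathcal{D}}(d,\mathbb{C})$ is the semigroup of all (not necessarily invertible) diagonal matrices in $\mathbb{C}^{d\times d}$.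
   Context: $\log$ of a positive number is the natural logarithm, $\log^+t=\max\{\log t,0\}$, $L^\dagger$ is the conjugate transpose of $L$, and $\sigma_{\max}$ is the largest singular value. $\log(L_1L_1^\dagger)$ is the matrix logarithm of the positive definite diagonal matrix $L_1L_1^\dagger$, i.e. the entrywise logarithm of its diagonal. $\mathbb{E}\log(L_1L_1^\dagger)$ is the diagonal matrix of the expectations of the diagonal entries, which lie in $[-\infty,\infty)$. $\lambda_{\max}$ and $\lambda_{\min}$ denote the largest and smallest eigenvalue, i.e. the largest and smallest diagonal entry of this diagonal matrix (entries equal to $-\infty$ being allowed). *)

(* Defs.v *)
From HB Require Import structures.
From mathcomp Require Import all_boot all_order all_algebra.
From mathcomp Require Import complex.
From mathcomp Require Import all_classical all_reals all_analysis.

Set Implicit Arguments.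
Unset Strict Implicit.
Unset Printing Implicit Defensive.

Import Order.TTheory GRing.Theory Num.Theory.

Local Open Scope classical_set_scope.
Local Open Scope ring_scope.
Local Open Scope complex_scope.
Local Open Scope sesquilinear_scope.

(* Measurability for the Borel sigma-algebra of C^(d x d), identified with
   R^(2 d^2) through the real and imaginary parts of the entries. *)
Definition measurable_mx (R : realType) (disp : measure_display)
    (T : measurableType disp) (d : nat) (L : T -> 'M[R[i]]_d) : Prop :=
  forall i j : 'I_d,
    measurable_fun [set: T] (fun w => complex.Re (L w i j)) /\
    measurable_fun [set: T] (fun w => complex.Im (L w i j)).

Definition inv_diag (R : realType) (d : nat) : set 'M[R[i]]_d :=
  [set A | is_diag_mx A /\ A \in unitmx].

Definition singular_value (R : realType) (d : nat) (A : 'M[R[i]]_d) (s : R) :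
    Prop :=
  0 <= s /\ eigenvalue (A *m A ^t*) ((s ^+ 2)%:C).

(* For 0 < d the set of singular values is finite and nonempty, so that its
   supremum is its largest element. *)
Definition sigma_max (R : realType) (d : nat) (A : 'M[R[i]]_d) : R :=
  sup [set s | singular_value A s].

(* The library value ln 0 = 0 agrees here with the convention log 0 = -oo. *)
Definition logp (R : realType) (t : R) : R := Num.max (ln t) 0.

(* Matrix logarithm, for a diagonal A with positive real diagonal entries. *)
Definition log_diag (R : realType) (d : nat) (A : 'M[R[i]]_d) : 'M[R]_d :=
  diag_mx (\row_i ln (complex.Re (A i i))).

Definition expectation_mx (R : realType) (disp : measure_display)
    (T : measurableType disp) (P : probability T R) (d : nat)
    (M : T -> 'M[R]_d) : 'M[\bar R]_d :=
  \matrix_(i, j) 'E_P[fun w => M w i j]%E.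

(* Largest and smallest eigenvalue of a diagonal matrix whose entries may be
   infinite; meant for 0 < d. *)
Definition lambda_max (R : realType) (d : nat) (D : 'M[\bar R]_d) : \bar R :=
  \big[maxe/-oo%E]_(i < d) D i i.

Definition lambda_min (R : realType) (d : nat) (D : 'M[\bar R]_d) : \bar R :=
  \big[mine/+oo%E]_(i < d) D i i.

Definition rank1_diag_states (R : realType) (d : nat) : set 'M[R[i]]_d :=
  [set X | exists Y : 'M[R[i]]_d,
    [/\ is_diag_mx Y, \rank Y = 1%N &
        X = (\tr (Y *m Y ^t*))^-1 *: (Y *m Y ^t*)]].

(* The trace is a positive real number when X is in rank1_diag_states and the
   values of L are in inv_diag; Re only casts it from R[i] to R. *)
Definition E_log_tr (R : realType) (disp : measure_display)
    (T : measurableType disp) (P : probability T R) (d : nat)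
    (L : T -> 'M[R[i]]_d) (X : 'M[R[i]]_d) : \bar R :=
  'E_P[fun w => ln (complex.Re (\tr (X *m L w *m (L w) ^t*)))].

Definition is_max_on (R : realType) (U : Type) (f : U -> \bar R) (A : set U)
    (m : \bar R) : Prop :=
  (exists2 x, A x & f x = m) /\ (forall x, A x -> (f x <= m)%E).

Definition is_min_on (R : realType) (U : Type) (f : U -> \bar R) (A : set U)
    (m : \bar R) : Prop :=
  (exists2 x, A x & f x = m) /\ (forall x, A x -> (m <= f x)%E).

(* Main.v *)
(** A diagonal matrix of rank one has exactly one nonzero entry, so the states
    in question are just the [d] coordinate projections. On the [i]-th of them
    the functional is the [i]-th diagonal entry of the expected logarithm, and
    both identities reduce to the extrema of a finite family. *)

Require Import Defs.
From HB Require Import structures.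
From mathcomp Require Import all_boot all_order all_algebra.
From mathcomp Require Import complex ring.
From mathcomp Require Import all_classical all_reals all_analysis.

Import Order.TTheory GRing.Theory Num.Theory.

Local Open Scope classical_set_scope.
Local Open Scope ring_scope.
Local Open Scope complex_scope.
Local Open Scope sesquilinear_scope.

Lemma mxtrace_delta_diag (A : pzSemiRingType) (d : nat) (i : 'I_d) :
  \tr (delta_mx i i : 'M[A]_d) = 1.
Proof.
rewrite /mxtrace (bigD1 i) //= big1 => [|j ji].
  by rewrite mxE eqxx addr0.
by rewrite mxE (negbTE ji).
Qed.

(** Rank one makes every 2x2 minor vanish; for a diagonal matrix this leaves at most one nonzero
    diagonal entry, and nonzero rank leaves at least one. Normalising by the trace then removes the
    remaining scalar. *)
Lemma rank1_diag_states_delta (R : realType) (d : nat) :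
  @rank1_diag_states R d = range (fun i : 'I_d => delta_mx i i).
Proof.
apply/seteqP; split => [X [Y [Ydiag Yrank ->]]|X [i _ <-]]; last first.
  (* The projection is its own witness: it is self-adjoint, idempotent and of trace 1. *)
  exists (delta_mx i i); split.
  - apply/is_diag_mxP => j k jk; rewrite mxE; case: eqP => [ji|//].
    by case: eqP => [ki|//]; move: jk; rewrite ji ki eqxx.
  - exact: mxrank_delta.
  have -> : (delta_mx i i : 'M[R[i]]_d) ^t* = delta_mx i i.
    apply/matrixP => j k; rewrite !mxE andbC.
    by case: (_ && _); rewrite ?rmorph1 ?rmorph0.
  by rewrite mul_delta_mx mxtrace_delta_diag invr1 scale1r.
have [c [r Ycr]] : exists (c : 'cV[R[i]]_d) (r : 'rV[R[i]]_d), Y = c *m r.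
  (* Both factors have [\rank Y] in their type, so they are generalised before that dimension
     becomes 1. *)
  rewrite -(mulmx_base Y); move: (col_base Y) (row_base Y).
  by rewrite Yrank => c r; exists c, r.
have Yoff (i j : 'I_d) : i != j -> Y i j = 0.
  by move: i j; apply/is_diag_mxP.
have minor (i j : 'I_d) : i != j -> Y i i * Y j j = 0.
  (* With [Y = c *m r], the diagonal and the off-diagonal product are the same four factors
     reordered. *)
  move=> ij; have : Y i j * Y j i = 0 by rewrite Yoff // mul0r.
  rewrite Ycr !mxE !big_ord1 => <-; ring.
have [i Yi0] : exists i, Y i i != 0.
  apply/not_existsP => Y0; have : Y = 0.
    apply/matrixP => i j; rewrite mxE.
    have [<-|/Yoff//] := eqVneq i j.
    by apply/eqP; apply/negPn/negP/Y0.
  by move=> Y0'; move: Yrank; rewrite Y0' mxrank0.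
have YE : Y = Y i i *: delta_mx i i.
  apply/matrixP => j k; rewrite !mxE.
  have [jk|jk] := eqVneq j k; last first.
    rewrite Yoff //; case: eqP => [ji|]; case: eqP => [ki|]; rewrite ?mulr0 //.
    by move: jk; rewrite ji ki eqxx.
  rewrite -jk andbb; have [->|ji] := eqVneq j i; first by rewrite mulr1.
  rewrite mulr0; apply/eqP; move: (minor _ _ ji) => /eqP.
  by rewrite mulf_eq0 (negbTE Yi0) orbF.
exists i => //; set a := Y i i in YE Yi0.
have -> : Y *m Y ^t* = (a * a^*) *: delta_mx i i.
  apply/matrixP => j k; rewrite !mxE (bigD1 i) //= big1 => [|l li].
    rewrite YE !mxE eqxx andbT addr0.
    by case: (j == i); case: (k == i);
      rewrite ?(mulr1, mulr0, mul0r, rmorph0, mulr0).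
  by rewrite YE !mxE (negbTE li) !andbF mulr0 mul0r.
(* The trace is [a * a^*], nonzero since [a] is, and cancels against the scalar. *)
rewrite mxtraceZ mxtrace_delta_diag mulr1 scalerA mulVf ?scale1r//.
by rewrite mulf_neq0 // conjC_eq0.
Qed.

(** The integrands agree pointwise: the projection keeps only row [i], so the trace is a single
    diagonal entry. *)
Lemma E_log_tr_delta (R : realType) (disp : measure_display)
    (T : measurableType disp) (P : probability T R) (d : nat)
    (L : T -> 'M[R[i]]_d) (i : 'I_d) :
  E_log_tr P L (delta_mx i i) =
    expectation_mx P (fun w => log_diag (L w *m (L w) ^t*)) i i.
Proof.
rewrite mxE /E_log_tr; congr expectation; apply/funext => w.
rewrite /log_diag !mxE eqxx mulr1n; congr (ln (complex.Re _)).
rewrite -mulmxA /mxtrace (bigD1 i) //= big1 ?addr0 => [|j ji].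
  by rewrite mxE (bigD1 i) //= big1 ?addr0 ?mxE ?eqxx ?mul1r // => j ji;
    rewrite !mxE (negbTE ji) andbF mul0r.
by rewrite mxE big1 // => k _; rewrite !mxE (negbTE ji) mul0r.
Qed.

Lemma lambda_max_is_max (R : realType) (d : nat) (D : 'M[\bar R]_d) :
  (0 < d)%N -> is_max_on (fun i => D i i) [set: 'I_d] (lambda_max D).
Proof.
move=> d_gt0; split => [|i _]; last first.
  exact: (@le_bigmax _ (\bar R) _ -oo%E (fun i => D i i)).
(* The initial value [-oo] lies below every entry and an index exists, so the maximum is attained at
   an entry. *)
have [i _ Di] := @eq_bigmax _ (\bar R) _ -oo%E (Ordinal d_gt0) xpredT
  (fun i => D i i) isT (fun i _ => leNye _).
by exists i; rewrite // -Di.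
Qed.

Lemma lambda_min_is_min (R : realType) (d : nat) (D : 'M[\bar R]_d) :
  (0 < d)%N -> is_min_on (fun i => D i i) [set: 'I_d] (lambda_min D).
Proof.
move=> d_gt0; split => [|i _]; last first.
  exact: (@bigmin_le _ (\bar R) _ +oo%E i (fun i => D i i)).
have [i _ Di] := @eq_bigmin _ (\bar R) _ +oo%E (Ordinal d_gt0) xpredT
  (fun i => D i i) isT (fun i _ => leey _).
by exists i; rewrite // -Di.
Qed.

Theorem mainTheorem5 (R : realType) (disp : measure_display)
    (T : measurableType disp) (P : probability T R) (d : nat)
    (L : T -> 'M[R[i]]_d) :
  (0 < d)%N ->
  measurable_mx L ->
  (forall w : T, inv_diag (L w)) ->
  ('E_P[fun w => logp (sigma_max (L w))] < +oo)%E ->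
  is_max_on (E_log_tr P L) (@rank1_diag_states R d)
    (lambda_max
       (expectation_mx P (fun w => log_diag (L w *m (L w) ^t*)))) /\
  is_min_on (E_log_tr P L) (@rank1_diag_states R d)
    (lambda_min
       (expectation_mx P (fun w => log_diag (L w *m (L w) ^t*)))).
Proof.
move=> d_gt0 _ _ _; rewrite rank1_diag_states_delta.
have [[i _ maxi] maxP] := lambda_max_is_max _ _
  (expectation_mx P (fun w => log_diag (L w *m (L w) ^t*))) d_gt0.
have [[j _ minj] minP] := lambda_min_is_min _ _
  (expectation_mx P (fun w => log_diag (L w *m (L w) ^t*))) d_gt0.
split; split.
(* An extremal index yields an extremal state, namely its projection. *)
- by exists (delta_mx i i); [exists i | rewrite E_log_tr_delta].
- by move=> _ [k _ <-]; rewrite E_log_tr_delta; exact: maxP.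
- by exists (delta_mx j j); [exists j | rewrite E_log_tr_delta].
- by move=> _ [k _ <-]; rewrite E_log_tr_delta; exact: minP.
Qed.
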